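(* Let $q$, $w$ and $d$ be fixed positive integers, where $d$ is odd, and let $t=\frac{2w-d+1}{2}$. Let $\overline{w}=(w_1,\dots,w_{q-1})$ be a fixed composition with $w=\sum_{i=1}^{q-1}w_i$. Then for sufficiently large integers $n$, $$A_q(n,d,\overline{w})\ge (1-o(1))\frac{\binom{n}{n-w,w_1,\dots,w_{q-1}}}{\binom{n-t}{w-t}f(\overline{w},w-t)},$$ where $o(1)\to 0$ as $n\to\infty$.
   Context: Let $\Sigma_q=\{0,1,\dots,q-1\}$. The composition of $\mathbf{x}\in\Sigma_q^n$ is $(w_1,\dots,w_{q-1})$ where $w_j$ is the number of coordinates of $\mathbf{x}$ equal to $j$; a composition $\overline{w}=(w_1,\dots,w_{q-1})$ consists of nonnegative integers. The Hamming distance $d(\mathbf{x},\mathbf{y})$ is the number of coordinates in which $\mathbf{x},\mathbf{y}$ differ. An $(n,d,\overline{w})_q$-constant composition code is a set $C\subseteq\Sigma_q^n$ in which every vector has composition $\overline{w}$ and any two distinct vectors have Hamming distance at least $d$; $A_q(n,d,\overline{w})$ is the maximum size of such a code. A vector $\overline{s}=(s_1,\dots,s_{q-1})$ of nonnegative integers is $(\overline{w},s)$-admissible if $\sum_i s_i=s$ and $s_i\le w_i$ for all $i$; and $f(\overline{w},s)=\max\frac{s!}{s_1!\cdots s_{q-1}!}$, the maximum taken over all $(\overline{w},s)$-admissible $\overline{s}$. $\binom{n}{n-w,w_1,\dots,w_{q-1}}$ is the multinomial coefficient. *)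

(* Defs.v *)
From mathcomp Require Import all_boot.

Set Implicit Arguments.
Unset Strict Implicit.
Unset Printing Implicit Defensive.

(* The alphabet {0, ..., q-1} is 'I_q and words of length n are finite functions
   'I_n -> 'I_q. A composition (w_1, ..., w_(q-1)) is indexed by 'I_q.-1: the
   index i : 'I_q.-1 stands for the nonzero symbol i.+1. *)

Definition composition_of (n q : nat) (x : {ffun 'I_n -> 'I_q}) :
    {ffun 'I_q.-1 -> nat} :=
  [ffun i : 'I_q.-1 => #|[set k : 'I_n | x k == i.+1 :> nat]|].

Definition hamming (n q : nat) (x y : {ffun 'I_n -> 'I_q}) : nat :=
  #|[set k : 'I_n | x k != y k]|.

Definition is_ccc (n q d : nat) (wbar : {ffun 'I_q.-1 -> nat})
    (C : {set {ffun 'I_n -> 'I_q}}) : bool :=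
  [forall x in C, composition_of x == wbar] &&
  [forall x in C, [forall y in C, (x != y) ==> (d <= hamming x y)]].

Definition max_ccc (n q d : nat) (wbar : {ffun 'I_q.-1 -> nat}) : nat :=
  \max_(C : {set {ffun 'I_n -> 'I_q}} | is_ccc d wbar C) #|C|.

(* n! / (k_1! ... k_m!), where ks = [:: k_1; ...; k_m] sums to n; the quotient
   is then exact. *)
Definition multinom (n : nat) (ks : seq nat) : nat :=
  n`! %/ \prod_(k <- ks) k`!.

Definition admissible (m : nat) (wbar : {ffun 'I_m -> nat}) (s : nat)
    (sbar : 'I_m -> nat) : bool :=
  (\sum_i sbar i == s) && [forall i, sbar i <= wbar i].

(* The entries of an admissible vector are at most s, so letting sbar range over
   the finite type {ffun 'I_m -> 'I_s.+1} loses no admissible vector. *)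
Definition fmax (m : nat) (wbar : {ffun 'I_m -> nat}) (s : nat) : nat :=
  \max_(sbar : {ffun 'I_m -> 'I_s.+1} | admissible wbar s (fun i => sbar i))
     multinom s [seq nat_of_ord (sbar i) | i : 'I_m].

(* Main.v *)
Require Import Defs.
From mathcomp Require Import all_boot all_order all_algebra perm.
From mathcomp Require Import reals sequences exp.
From mathcomp Require Import ring lra zify.

(* Regard the words of composition [wbar] as the edges of a hypergraph whose
   vertices are the words with [t] nonzero symbols that they extend, together
   with the [t.+1]-subsets of their supports. Two words with disjoint vertex sets
   are at distance at least [d], so a matching is a code. A word with [t] nonzero
   symbols has at most [D = 'C(n - t, w - t) * fmax wbar (w - t)] extensions, all
   other degrees and all codegrees are O(D / n), and the symmetric group acts
   transitively on the edges; hence it suffices to find a matching of almost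
   |E| / D edges.

   This is done by a nibble with a bounded number of rounds. In each round every
   live edge is picked independently with probability about eps / D, and the
   vertices of the picked edges die. The probability that a bounded set S of
   vertices is live after round j converges, as the codegrees become o(D), to the
   product over S of numbers f_j(v) given by the mean-field recursion
   f_(j+1)(v) = f_j(v) exp(- eps h_j(v)): by induction on j, since the first two
   moments of the live degree of v on the event that S is live are averages of
   such probabilities for the larger sets S :|: e and S :|: e :|: e', the live
   degree concentrates at D h_j(v). By transitivity the product F_j of f_j over
   an edge does not depend on the edge, so f_j(v) >= 1 - eps * (F_0 + ... +
   F_(j-1)), which forces eps * (F_0 + ... + F_(T-1)) to approach 1. Up to a
   factor 1 - O(eps) this sum is D / |E| times the expected number of picked edges
   that meet no other edge picked in the same round, and these form a matching. *)

Set Implicit Arguments.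
Unset Strict Implicit.
Unset Printing Implicit Defensive.
Import Order.TTheory GRing.Theory Num.Theory.
Local Open Scope ring_scope.

(** * The nibble *)

Section RandomSubset.
Variables (R : realType) (E : finType) (p : R).

Definition bernoulli_weight (X : {set E}) : R :=
  \prod_e (if e \in X then p else 1 - p).

Local Notation mu := bernoulli_weight.

Lemma bernoulli_weight_ge0 (X : {set E}) : 0 <= p <= 1 -> 0 <= mu X.
Proof.
by move=> /andP[p0 p1]; apply: prodr_ge0 => e _; case: ifP => // _; lra.
Qed.

Lemma sum_bernoulli_weight : \sum_X mu X = 1.
Proof.
rewrite /mu; have := @bigA_distr R 0 1 *%R +%R E (fun=> p) (fun=> 1 - p).
by move=> <-; rewrite big1 //= => e _; ring.
Qed.

(** Expanding the product over [e] of [a e + b e] gives a sum over all [X]; taking [a e = 0] on [B]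
    kills the terms whose [X] meets [B]. *)
Lemma sum_bernoulli_weight_disjoint (B : {set E}) :
  \sum_X mu X * [disjoint X & B]%:R = (1 - p) ^+ #|B|.
Proof.
have := @bigA_distr R 0 1 *%R +%R E (fun e => p * (e \notin B)%:R) (fun=> 1 - p).
rewrite (bigID (mem B)) /= [X in _ * X]big1 => [|e eB]; last first.
  move: eB; rewrite /= => ->; rewrite ?mulr1n; ring.
under eq_bigr => e eB do rewrite eB mulr0 add0r.
rewrite prodr_const mulr1 => ->; apply: eq_bigr => X _.
have [dXB|/pred0Pn[e /andP[/= eX eB]]] := boolP [disjoint X & B].
  rewrite mulr1; apply: eq_bigr => e _; case: ifP => // eX.
  by rewrite (disjointFr dXB eX) mulr1.
by rewrite mulr0 [RHS](bigD1 e) //= eX eB mulr0 mul0r.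
Qed.

(** The same expansion; setting the second summand to 0 at [e0] forces [e0] into [X]. *)
Lemma sum_bernoulli_weight_mem_disjoint (e0 : E) (B : {set E}) : e0 \notin B ->
  \sum_X mu X * ((e0 \in X) && [disjoint X & B])%:R = p * (1 - p) ^+ #|B|.
Proof.
move=> e0B.
have := @bigA_distr R 0 1 *%R +%R E (fun e => p * (e \notin B)%:R)
  (fun e => (1 - p) * (e != e0)%:R).
rewrite (bigD1 e0) //= e0B eqxx mulr0 addr0 mulr1n mulr1 (bigID (mem B)) /=.
rewrite [X in _ * (_ * X)]big1 => [|e /andP[ee0 eB]]; last first.
  rewrite eB ee0 /=; rewrite ?mulr1n; ring.
rewrite (eq_bigr (fun=> 1 - p)) => [|e /andP[ee0 eB]]; last first.
  by rewrite eB ee0 mulr0 add0r mulr1n mulr1.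
rewrite (eq_bigl (mem B)) => [|e /=]; last first.
  by have [->|_] /= := eqVneq e e0; rewrite ?(negPf e0B).
rewrite prodr_const mulr1 => ->; apply: eq_bigr => X _.
have [e0X|e0X] /= := boolP (e0 \in X); last first.
  by rewrite mulr0 [RHS](bigD1 e0) //= (negPf e0X) eqxx mulr0 mul0r.
have [dXB|/pred0Pn[e /andP[/= eX eB]]] := boolP [disjoint X & B].
  rewrite mulr1; apply: eq_bigr => e _; case: ifP => eX.
    by rewrite (disjointFr dXB eX) mulr1.
  by have [ee0|_] := eqVneq e e0; rewrite ?mulr1 // -ee0 eX in e0X *.
by rewrite mulr0 [RHS](bigD1 e) //= eX eB mulr0 mul0r.
Qed.

End RandomSubset.

(** * One round of the nibble and its mean-field recursion *)

Section Nibble.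
Variables (R : realType) (V E : finType) (inc : E -> {set V}) (D eps : R).

(* With this choice the probability that none of [k] edges is picked is exactly
   [expR (- (eps * k / D))]. *)
Definition pick_prob : R := 1 - expR (- (eps / D)).

(* A picked live edge kills its vertices even when it meets another picked edge. *)
Definition survivors (A : {set V}) (X : {set E}) : {set V} :=
  A :\: \bigcup_(e in X | inc e \subset A) inc e.

(* Expected value of [g] at the set of vertices that survive one round from [A];
   its iterates are the expectations after several rounds. *)
Definition nibble (g : {set V} -> R) (A : {set V}) : R :=
  \sum_X bernoulli_weight pick_prob X * g (survivors A X).

Definition ind (S A : {set V}) : R := (S \subset A)%:R.

Definition live_prob (j : nat) (S : {set V}) : R := iter j nibble (ind S) setT.

(** The expected live degree of [v] in units of [D], given that [v] is live, if the other vertices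
    [u] were live independently with probability [f u]. *)
Definition mean_link (f : V -> R) (v : V) : R :=
  D^-1 * \sum_(e | v \in inc e) \prod_(u in inc e :\ v) f u.

(* The recursion satisfied by [j, v |-> live_prob j [set v]] when distinct vertices
   survive independently. *)
Fixpoint live_lim (j : nat) (v : V) : R :=
  if j is k.+1 then live_lim k v * expR (- (eps * mean_link (live_lim k) v))
  else 1.

Lemma iter_nibble_sum (I : finType) (P : pred I) (F : I -> {set V} -> R) j A :
  iter j nibble (fun A => \sum_(i | P i) F i A) A =
  \sum_(i | P i) iter j nibble (F i) A.
Proof.
elim: j A => [//|j IHj] A; rewrite iterS /nibble.
under eq_bigr => X _ do rewrite IHj mulr_sumr.
by rewrite exchange_big.
Qed.

Lemma iter_nibbleD (g h : {set V} -> R) j A :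
  iter j nibble (fun A => g A + h A) A = iter j nibble g A + iter j nibble h A.
Proof.
elim: j A => [//|j IHj] A; rewrite !iterS /nibble -big_split /=.
by apply: eq_bigr => X _; rewrite IHj mulrDr.
Qed.

Lemma iter_nibbleZ (c : R) (g : {set V} -> R) j A :
  iter j nibble (fun A => c * g A) A = c * iter j nibble g A.
Proof.
elim: j A => [//|j IHj] A; rewrite !iterS /nibble mulr_sumr.
by apply: eq_bigr => X _; rewrite IHj mulrCA.
Qed.

Lemma iter_nibble_cst (c : R) j A : iter j nibble (fun=> c) A = c.
Proof.
elim: j A => [//|j IHj] A; rewrite iterS /nibble.
under eq_bigr => X _ do rewrite IHj.
by rewrite -mulr_suml sum_bernoulli_weight mul1r.
Qed.

Lemma eq_iter_nibble (g h : {set V} -> R) j A :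
  g =1 h -> iter j nibble g A = iter j nibble h A.
Proof.
move=> gh; elim: j A => [|j IHj] A /=; first exact: gh.
by apply: eq_bigr => X _; rewrite IHj.
Qed.

Hypotheses (D_gt0 : 0 < D) (eps_ge0 : 0 <= eps).

Lemma pick_prob_itv : 0 <= pick_prob <= 1.
Proof.
have e0 : 0 <= expR (- (eps / D)) by exact: expR_ge0.
have e1 : expR (- (eps / D)) <= 1 by rewrite expR_le1 oppr_le0 divr_ge0 // ltW.
by rewrite /pick_prob; lra.
Qed.

Lemma le_iter_nibble (g h : {set V} -> R) j A :
  (forall A, g A <= h A) -> iter j nibble g A <= iter j nibble h A.
Proof.
move=> gh; elim: j A => [//|j IHj] A; rewrite !iterS /nibble.
by apply: ler_sum => X _; rewrite ler_wpM2l ?bernoulli_weight_ge0 ?pick_prob_itv.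
Qed.

Lemma expr_pick_prob k : (1 - pick_prob) ^+ k = expR (- (eps * (D^-1 * k%:R))).
Proof. by rewrite /pick_prob subKr -expRM_natr mulrA mulNr. Qed.

(** A live set [S] survives the round exactly when no live edge meeting it is picked; each such edge
    contributes a factor [1 - pick_prob]. *)
Lemma nibble_ind (S A : {set V}) : nibble (ind S) A = ind S A *
  expR (- (eps * (D^-1 *
    #|[set e | (inc e \subset A) && ~~ [disjoint inc e & S]]|%:R))).
Proof.
rewrite -expr_pick_prob -sum_bernoulli_weight_disjoint mulr_sumr /nibble.
apply: eq_bigr => X _; rewrite mulrCA; congr (_ * _); rewrite /ind -natrM mulnb.
congr (nat_of_bool _)%:R; rewrite /survivors subsetD; congr andb.
apply/idP/idP => [dS|dX].
  apply/pred0Pn => -[e /andP[/= eX]]; rewrite inE => /andP[eA /negP[]].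
  rewrite disjoint_sym; apply: disjointWr dS.
  by apply: (bigcup_max e); rewrite ?eX.
apply/bigcup_disjointP => e /andP[eX eA]; rewrite disjoint_sym.
by apply/contraT => ndS; have := disjointFr dX eX; rewrite inE eA ndS.
Qed.

Lemma live_lim_itv j v : 0 <= live_lim j v <= 1.
Proof.
elim: j v => [|j IHj] v /=; first by rewrite ler01 lexx.
have /andP[f0 f1] := IHj v; rewrite mulr_ge0 ?expR_ge0 //= mulr_ile1 ?expR_ge0 //.
rewrite expR_le1 oppr_le0 mulr_ge0 // mulr_ge0 ?invr_ge0 ?(ltW D_gt0) //.
by apply: sumr_ge0 => e _; apply: prodr_ge0 => u _; case/andP: (IHj u).
Qed.

Variables (r : nat) (delta : R).
Hypotheses (delta_ge0 : 0 <= delta)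
  (inc_le : forall e, (#|inc e| <= r)%N)
  (deg_le : forall v, #|[set e | v \in inc e]|%:R <= D)
  (codeg_le : forall u v, u != v ->
     #|[set e | (u \in inc e) && (v \in inc e)]|%:R <= delta * D).

Lemma sum_deg_le (g : E -> R) c v : (forall e, v \in inc e -> `|g e| <= c) ->
  0 <= c -> `|D^-1 * \sum_(e | v \in inc e) g e| <= c.
Proof.
move=> gc c0; rewrite normrM ger0_norm ?invr_ge0 ?(ltW D_gt0) // mulrC ler_pdivrMr //.
apply: le_trans (ler_norm_sum _ _ _) _.
apply: (le_trans (ler_sum _ gc)); rewrite sumr_const -mulr_natr ler_wpM2l //.
by apply: le_trans (deg_le v); rewrite ler_nat subset_leq_card //;
  apply/subsetP => e; rewrite inE.
Qed.

(** Double counting: each [u] in [S] other than [v] lies in at most [delta * D] of the edges at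
    [v]. *)
Lemma sum_codeg_le (S : {set V}) v :
  D^-1 * \sum_(e | v \in inc e) \sum_(u in S :\ v) (u \in inc e)%:R
    <= #|S|%:R * delta.
Proof.
rewrite mulrC ler_pdivrMr // exchange_big /= -mulrA.
apply: (@le_trans _ _ (\sum_(u in S :\ v) delta * D)).
  apply: ler_sum => u; rewrite !inE => /andP[uv _].
  apply: le_trans (codeg_le uv); rewrite -natr_sum ler_nat -sum1_card.
  rewrite big_mkcond [leqRHS]big_mkcond /= leq_sum // => e _.
  by rewrite inE andbC; case: (v \in _) => //; case: (u \in _).
rewrite sumr_const -[leLHS]mulr_natl ler_wpM2r ?mulr_ge0 ?(ltW D_gt0) //.
by rewrite ler_nat subset_leq_card // subD1set.
Qed.

Lemma prod_itv (f : V -> R) (S : {set V}) : (forall v, 0 <= f v <= 1) ->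
  0 <= \prod_(v in S) f v <= 1.
Proof.
move=> f01; rewrite prodr_ge0 => [|v _]; last by case/andP: (f01 v).
by apply: prodr_ile1 => v _.
Qed.

Lemma mean_link_itv (f : V -> R) v : (forall v, 0 <= f v <= 1) ->
  0 <= mean_link f v <= 1.
Proof.
move=> f01; rewrite mulr_ge0 ?invr_ge0 ?(ltW D_gt0) //=; last first.
  by apply: sumr_ge0 => e _; case/andP: (prod_itv (inc e :\ v) f01).
apply: le_trans (ler_norm _) _; apply: sum_deg_le => // e _.
by have /andP[? ?] := prod_itv (inc e :\ v) f01; rewrite ger0_norm.
Qed.

(** The product over [S :|: inc e] factors exactly unless [e] meets [S] outside [v]. Each
    exceptional edge costs at most 1, and [sum_codeg_le] bounds their number. *)
Lemma mean_link_prod (f : V -> R) (S : {set V}) v :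
  (forall v, 0 <= f v <= 1) -> v \in S ->
  `|D^-1 * \sum_(e | v \in inc e) \prod_(u in S :|: inc e) f u
    - \prod_(u in S) f u * mean_link f v| <= #|S|%:R * delta.
Proof.
move=> f01 vS; rewrite /mean_link mulrCA -mulrBr mulr_sumr -sumrB normrM.
rewrite ger0_norm ?invr_ge0 ?(ltW D_gt0) //; apply: le_trans (sum_codeg_le S v).
rewrite ler_pM2l ?invr_gt0 //; apply: le_trans (ler_norm_sum _ _ _) _.
apply: ler_sum => e ve.
have [dS|/pred0Pn[u /andP[/= uS uev]]] := boolP [disjoint S & inc e :\ v].
  rewrite -bigU //= [X in _ - X](eq_bigl (mem (S :|: inc e))).
    by rewrite subrr normr0 sumr_ge0.
  by move=> u; rewrite !inE; have [->|] := eqVneq u v; rewrite ?vS ?ve.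
have /andP[a0 a1] := prod_itv (S :|: inc e) f01.
have /andP[b0 b1] := prod_itv S f01.
have /andP[c0 c1] := prod_itv (inc e :\ v) f01.
apply: (@le_trans _ _ 1).
  have := mulr_ge0 b0 c0; have := mulr_ile1 b0 c0 b1 c1.
  by move=> *; rewrite ler_norml; lra.
move: uev; rewrite !inE => /andP[uv ue].
by rewrite (bigD1 u) /= ?inE ?uv ?uS // ue lerDl sumr_ge0.
Qed.


Lemma expR_dist (a b : R) : 0 <= a -> 0 <= b ->
  `|expR (- a) - expR (- b)| <= `|a - b|.
Proof.
wlog ab : a b / a <= b => [hw a0 b0|a0 b0].
  by case/orP: (le_total a b) => ab; [|rewrite distrC (distrC a)]; apply: hw.
have -> : expR (- b) = expR (- a) * expR (- (b - a)) by rewrite -expRD; congr expR; ring.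
have a1 : expR (- a) <= 1 by rewrite expR_le1 oppr_le0.
have := expR_ge0 (- a); have := expR_ge1Dx (- (b - a)).
have : expR (- (b - a)) <= 1 by rewrite expR_le1 oppr_le0 subr_ge0.
move=> e1 e2 e3; rewrite [leRHS]ler0_norm ?subr_le0 // ler_norml.
by apply/andP; split; nra.
Qed.

(** A linear substitute for the Cauchy-Schwarz inequality: it bounds a first absolute moment by a
    second moment, with [kappa] free to be tuned. *)
Lemma norm_le_sqr (kappa z : R) : 0 < kappa -> `|z| <= kappa + kappa^-1 * (z * z).
Proof.
move=> k0; rewrite -(ler_pM2l k0) mulrDr mulrA divff ?gt_eqF // mul1r.
by case: (ger0P z) => _; nra.
Qed.

Definition live_degree (v : V) (A : {set V}) : R :=
  D^-1 * \sum_(e | v \in inc e) ind (inc e) A.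

Lemma ind_mul (S T A : {set V}) : ind S A * ind T A = ind (S :|: T) A.
Proof. by rewrite /ind subUset -natrM mulnb. Qed.

(** The sum of live degrees counts a live edge once for each of its vertices in [S]. The overcount
    comes from edges with two vertices in [S], which are few by the codegree bound. *)
Lemma live_degree_touch (S A : {set V}) :
  `|D^-1 * #|[set e | (inc e \subset A) && ~~ [disjoint inc e & S]]|%:R
    - \sum_(v in S) live_degree v A| <= #|S|%:R * (#|S|%:R * delta).
Proof.
rewrite /live_degree -mulr_sumr -mulrBr normrM ger0_norm ?invr_ge0 ?(ltW D_gt0) //.
rewrite (exchange_big_dep predT) //= -sum1_card natr_sum big_mkcond /= -sumrB.
apply: (@le_trans _ _ (D^-1 * \sum_(v in S) \sum_(e | v \in inc e)
    \sum_(u in S :\ v) (u \in inc e)%:R)); last first.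
  rewrite mulr_sumr -[X in _ <= X%:R * _]sum1_card.
  rewrite natr_sum mulr_suml; apply: ler_sum => v _; rewrite mul1r.
  exact: sum_codeg_le.
rewrite ler_pM2l ?invr_gt0 // (exchange_big_dep predT) //=.
apply: le_trans (ler_norm_sum _ _ _) _; apply: ler_sum => e _.
have inner_ge0 v : 0 <= \sum_(u in S :\ v) (u \in inc e)%:R :> R by exact: sumr_ge0.
rewrite inE /ind; have [eA|_] /= := boolP (inc e \subset A); last first.
  by rewrite big1 // subrr normr0 sumr_ge0.
have [dS|/pred0Pn[v /andP[/= ve vS]]] := boolP [disjoint inc e & S].
  rewrite big_pred0 ?subrr ?normr0 ?sumr_ge0 // => v.
  by apply/negbTE/negP => /andP[vS ve]; have := disjointFr dS ve; rewrite vS.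
rewrite (bigD1 v) /= ?vS // opprD addrA subrr sub0r normrN.
rewrite ger0_norm ?sumr_ge0 // [leRHS](bigD1 v) /= ?vS //.
rewrite -[leLHS]addr0 lerD ?sumr_ge0 // big_mkcond [leRHS]big_mkcond /=.
by apply: ler_sum => u _; rewrite !inE andbC; case: (u \in S); case: (u == v);
  case: (u \in inc e).
Qed.

(** * Induction step: from round [j] to round [j.+1] *)

Section Step.
Variables (j m : nat) (eta kappa : R).
Hypotheses (eta_ge0 : 0 <= eta) (kappa_gt0 : 0 < kappa).

Let f := live_lim j.
Let F (S : {set V}) := \prod_(v in S) f v.

Lemma live_prob_link (n : nat) (S : {set V}) v :
  (forall T : {set V}, (#|T| <= n + r)%N -> `|live_prob j T - F T| <= eta) ->
  (#|S| <= n)%N -> v \in S ->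
  `|D^-1 * \sum_(e | v \in inc e) live_prob j (S :|: inc e) - F S * mean_link f v|
    <= eta + n%:R * delta.
Proof.
move=> close Sn vS.
have f01 := live_lim_itv j.
have Sdelta : #|S|%:R * delta <= n%:R * delta by rewrite ler_wpM2r // ler_nat.
have := le_trans (mean_link_prod f01 vS) Sdelta.
have : `|D^-1 * \sum_(e | v \in inc e) (live_prob j (S :|: inc e) - F (S :|: inc e))| <= eta.
  apply: sum_deg_le => // e _; apply: close.
  by apply: leq_trans (leq_card_setU _ _) _; rewrite leq_add.
rewrite sumrB mulrBr -/f => d1 d2.
by apply: le_trans (lerD d1 d2); apply: le_trans (ler_normD _ _); rewrite addrA subrK.
Qed.

Hypothesis close : forall S : {set V}, (#|S| <= m + r + r)%N -> `|live_prob j S - F S| <= eta.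

(** Expanding the square gives averages of the live probabilities of [S :|: inc e] and
    [S :|: inc e :|: inc g], hence the size [m + r + r] in [close]. They are close to [F S * h] and
    [F S * h * h], so the main terms cancel. *)
Lemma live_degree_variance (S : {set V}) v : (#|S| <= m)%N -> v \in S ->
  iter j nibble (fun A => ind S A *
     ((live_degree v A - mean_link f v) * (live_degree v A - mean_link f v))) setT
  <= 4 * eta + (4 * m%:R + r%:R) * delta.
Proof.
move=> Sm vS; set h := mean_link f v.
have f01 := live_lim_itv j.
have /andP[h0 h1] : 0 <= h <= 1 by apply: mean_link_itv.
have /andP[F0 F1] := prod_itv S f01.
pose q1 := D^-1 * \sum_(e | v \in inc e) live_prob j (S :|: inc e).
pose q2 := D^-1 * \sum_(e | v \in inc e)
  (D^-1 * \sum_(g | v \in inc g) live_prob j (S :|: inc e :|: inc g)).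
have -> : iter j nibble (fun A => ind S A * ((live_degree v A - h) *
  (live_degree v A - h))) setT
    = q2 + (- (2 * h)) * q1 + h * h * live_prob j S.
  rewrite /live_prob /q1 /q2 /live_prob -!iter_nibble_sum -!iter_nibbleZ.
  under eq_bigr => e _ do rewrite -iter_nibble_sum -iter_nibbleZ.
  rewrite -iter_nibble_sum -!iter_nibbleZ -!iter_nibbleD.
  apply: eq_iter_nibble => A.
  have e1 : \sum_(e | v \in inc e) ind (S :|: inc e) A = ind S A * (D * live_degree v A).
    rewrite /live_degree mulVKf ?gt_eqF // mulr_sumr.
    by apply: eq_bigr => e _; rewrite ind_mul.
  rewrite e1; have -> : \sum_(e | v \in inc e)
      D^-1 * (\sum_(g | v \in inc g) ind (S :|: inc e :|: inc g) A)
      = ind S A * (D * live_degree v A) * live_degree v A.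
    rewrite -e1 mulr_suml; apply: eq_bigr => e _.
    rewrite /live_degree mulrCA; congr (_ * _); rewrite mulr_sumr.
    by apply: eq_bigr => g _; rewrite ind_mul.
  by field; rewrite gt_eqF.
have d1 : `|q1 - F S * h| <= eta + m%:R * delta.
  by apply: live_prob_link => // T Tm; apply: close; apply: leq_trans Tm _; rewrite leq_addr.
have d2 : `|q2 - F S * h * h| <= eta + (m + r)%:R * delta + m%:R * delta.
  have Sdelta : #|S|%:R * delta <= m%:R * delta by rewrite ler_wpM2r // ler_nat.
  have dF : `|h * (D^-1 * \sum_(e | v \in inc e) F (S :|: inc e) - F S * h)| <= m%:R * delta.
    rewrite normrM ger0_norm //; apply: le_trans (ler_piMl _ h1) _ => //.
    exact: le_trans (mean_link_prod f01 vS) Sdelta.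
  have : `|D^-1 * \sum_(e | v \in inc e)
     ((D^-1 * \sum_(g | v \in inc g) live_prob j (S :|: inc e :|: inc g))
       - F (S :|: inc e) * h)| <= eta + (m + r)%:R * delta.
    apply: sum_deg_le; last by rewrite addr_ge0 // mulr_ge0.
    move=> e ve; apply: live_prob_link; rewrite ?inE ?vS //.
    by apply: leq_trans (leq_card_setU _ _) _; rewrite leq_add.
  rewrite sumrB mulrBr -/q2 => dq; apply: le_trans (lerD dq dF).
  apply: le_trans (ler_normD _ _); rewrite -mulr_suml.
  by rewrite le_eqVlt; apply/orP; left; apply/eqP; congr `|_|; ring.
have d0 : `|live_prob j S - F S| <= eta.
  by apply: close; apply: leq_trans Sm _; rewrite -addnA leq_addr.
move: d0 d1 d2; rewrite natrD !ler_norml => /andP[p1 p2] /andP[p3 p4] /andP[p5 p6].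
have hh0 := mulr_ge0 h0 h0; have hh1 := mulr_ile1 h0 h0 h1 h1.
have b0 : 0 <= eta + m%:R * delta by rewrite addr_ge0 // mulr_ge0.
have t1 : h * h * (live_prob j S - F S) <= eta.
  exact: le_trans (ler_wpM2l hh0 p2) (ler_piMl _ hh1).
have t2 : - (h * (q1 - F S * h)) <= eta + m%:R * delta.
  rewrite lerNl; apply: le_trans _ (ler_wpM2l h0 p3).
  by rewrite mulrN lerN2; apply: ler_piMl.
by lra.
Qed.

Lemma iter_nibble_dist (g h k : {set V} -> R) A :
  (forall A, `|g A - h A| <= k A) ->
  `|iter j nibble g A - iter j nibble h A| <= iter j nibble k A.
Proof.
move=> ghk; have gh B : g B <= h B + k B /\ h B <= g B + k B.
  by have := ghk B; rewrite ler_norml => /andP[? ?]; split; lra.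
have := le_iter_nibble j A (fun B => (gh B).1); rewrite iter_nibbleD.
have := le_iter_nibble j A (fun B => (gh B).2); rewrite iter_nibbleD.
by rewrite ler_norml => *; apply/andP; split; lra.
Qed.

(** Given the state after [j] rounds, one more round multiplies [ind S] by the exponential in
    [nibble_ind]. Its exponent is governed by the live degrees in [S], which concentrate by
    [live_degree_variance], so the constant [c] can replace it. *)
Lemma live_prob_step (S : {set V}) : (#|S| <= m)%N ->
  `|live_prob j.+1 S - \prod_(v in S) live_lim j.+1 v| <= eta + eps *
    (m%:R * (m%:R * delta) +
     m%:R * (kappa + kappa^-1 * (4 * eta + (4 * m%:R + r%:R) * delta))).
Proof.
move=> Sm; have f01 := live_lim_itv j.
pose h v := mean_link f v; pose c := expR (- (eps * \sum_(v in S) h v)).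
have h01 v : 0 <= h v <= 1 by exact: mean_link_itv.
have H0 : 0 <= \sum_(v in S) h v by apply: sumr_ge0 => v _; case/andP: (h01 v).
have c01 : 0 <= c <= 1 by rewrite expR_ge0 expR_le1 oppr_le0 mulr_ge0.
have -> : \prod_(v in S) live_lim j.+1 v = F S * c.
  by rewrite big_split /= -expR_sum sumrN /c mulr_sumr.
have Sm' : #|S|%:R <= m%:R :> R by rewrite ler_nat.
pose var v A := ind S A * ((live_degree v A - h v) * (live_degree v A - h v)).
have var_ge0 v A : 0 <= var v A by rewrite mulr_ge0 // -expr2 sqr_ge0.
(* The pointwise error of this replacement: the first term is the overcount in [live_degree_touch],
   the second comes from [norm_le_sqr]. *)
pose k A := eps * (m%:R * (m%:R * delta) + \sum_(v in S) (kappa + kappa^-1 * var v A)).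
have k_ge0 A : 0 <= k A.
  rewrite mulr_ge0 // addr_ge0 ?mulr_ge0 //; apply: sumr_ge0 => v _.
  by rewrite addr_ge0 ?(ltW kappa_gt0) // mulr_ge0 // invr_ge0 ltW.
have step A : `|nibble (ind S) A - c * ind S A| <= k A.
  rewrite nibble_ind mulrC -mulrBl normrM /ind.
  have [SA|_] := boolP (S \subset A); last by rewrite normr0 mulr0.
  rewrite normr1 mulr1; apply: le_trans (expR_dist _ _) _;
    rewrite ?mulr_ge0 ?invr_ge0 ?(ltW D_gt0) //.
  rewrite -mulrBr normrM ger0_norm // ler_wpM2l //.
  apply: le_trans (ler_distD (\sum_(v in S) live_degree v A) _ _) _.
  rewrite lerD //.
    apply: le_trans (live_degree_touch _ _) _.
    by rewrite ler_pM ?mulr_ge0 // ler_wpM2r.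
  rewrite -sumrB; apply: le_trans (ler_norm_sum _ _ _) _.
  apply: ler_sum => v vS; rewrite /var /ind SA mul1r; exact: norm_le_sqr.
have := iter_nibble_dist setT step.
(* The round split off is the last one: the innermost [nibble] acts on the state after [j]
   rounds. *)
rewrite -iterSr iter_nibbleZ iter_nibbleZ iter_nibbleD iter_nibble_cst iter_nibble_sum.
rewrite -/(live_prob _ _) -/(live_prob _ _) => close1.
have close0 : `|c * live_prob j S - F S * c| <= eta.
  rewrite mulrC -mulrBl normrM; have /andP[c0 c1] := c01.
  rewrite (ger0_norm c0); apply: le_trans (ler_piMr _ c1) _ => //.
  by apply: close; apply: leq_trans Sm _; rewrite -addnA leq_addr.
apply: le_trans (ler_distD (c * live_prob j S) _ _) _; rewrite addrC lerD //.
apply: le_trans close1 _; rewrite ler_wpM2l // lerD2l.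
apply: (@le_trans _ _ (\sum_(v in S)
   (kappa + kappa^-1 * (4 * eta + (4 * m%:R + r%:R) * delta)))).
  apply: ler_sum => v vS; rewrite iter_nibbleD iter_nibble_cst iter_nibbleZ lerD2l.
  by rewrite ler_wpM2l ?invr_ge0 ?(ltW kappa_gt0) //; apply: live_degree_variance.
rewrite sumr_const -[leLHS]mulr_natl ler_wpM2r // addr_ge0 ?(ltW kappa_gt0) //.
by rewrite !(mulr_ge0, addr_ge0, invr_ge0) // ltW.
Qed.

End Step.
End Nibble.

(** Induction on [T] with [m] and [eta] free: one more round requires the earlier ones to be
    approximated on sets of size up to [m + r + r] and with a smaller error. As [delta] is fixed
    before the hypergraph, the estimate is uniform. *)
Lemma live_prob_approx (R : realType) (eps : R) (r T m : nat) (eta : R) :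
  0 < eps -> 0 < eta -> exists2 delta : R, 0 < delta &
  forall (V E : finType) (inc : E -> {set V}) (D : R), 0 < D ->
    (forall e, (#|inc e| <= r)%N) ->
    (forall v, #|[set e | v \in inc e]|%:R <= D) ->
    (forall u v, u != v ->
       #|[set e | (u \in inc e) && (v \in inc e)]|%:R <= delta * D) ->
  forall j (S : {set V}), (j <= T)%N -> (#|S| <= m)%N ->
    `|live_prob inc D eps j S - \prod_(v in S) live_lim inc D eps j v| <= eta.
Proof.
move=> eps0; elim: T m eta => [|T IHT] m eta eta0.
  exists 1 => // V E inc D _ _ _ _ [|//] S _ _.
  by rewrite /live_prob /= /ind subsetT big1 // subrr normr0 ltW.
have m0 : 0 <= m%:R :> R by []; have r0 : 0 <= r%:R :> R by [].
(* Half of [eta] is left to the term [eps * m * kappa], the other half to [K * eta1], where [K]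
   collects the remaining coefficients once [delta] is bounded by [eta1]. *)
pose kappa := eta / (2 * (eps * (m%:R + 1))).
have kappa0 : 0 < kappa by rewrite divr_gt0 // !mulr_gt0 // ltr_wpDl.
pose K := 1 + eps * (m%:R * m%:R + m%:R * (kappa^-1 * (4 + (4 * m%:R + r%:R)))).
have K1 : 1 <= K.
  by rewrite lerDl !(mulr_ge0, addr_ge0, invr_ge0) // ltW.
have K0 : 0 < K by exact: lt_le_trans K1.
pose eta1 := eta / (2 * K).
have eta10 : 0 < eta1 by rewrite divr_gt0 // mulr_gt0.
have eta1_le : eta1 <= eta.
  by rewrite ler_pdivrMr ?mulr_gt0 // ler_peMr ?ltW //; lra.
have [delta1 delta10 IH] := IHT (m + r + r)%N eta1 eta10.
exists (Num.min delta1 eta1); first by rewrite lt_min delta10.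
move=> V E inc D D0 incr deg codeg j S.
have le1 : Num.min delta1 eta1 <= delta1 by rewrite ge_min lexx.
have le2 : Num.min delta1 eta1 <= eta1 by rewrite ge_min lexx orbT.
have ge0 : 0 <= Num.min delta1 eta1 by rewrite le_min !ltW.
have IHj i (S' : {set V}) : (i <= T)%N -> (#|S'| <= m + r + r)%N ->
    `|live_prob inc D eps i S' - \prod_(v in S') live_lim inc D eps i v| <= eta1.
  apply: IH => // u v uv; apply: le_trans (codeg u v uv) _.
  by rewrite ler_wpM2r // ltW.
rewrite leq_eqVlt ltnS => /orP[/eqP-> Sm|jT Sm]; last first.
  by apply: le_trans eta1_le; apply: IHj => //; apply: leq_trans Sm _; rewrite -addnA leq_addr.
have := live_prob_step D0 (ltW eps0) ge0 incr deg codeg (ltW eta10) kappa0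
  (fun S' => IHj T S' (leqnn T)) Sm.
move=> /le_trans; apply; set d := Num.min _ _ in le2 ge0 *.
have kE : eps * (m%:R * kappa) <= eta / 2.
  have -> : eps * (m%:R * kappa) = eta / 2 * (m%:R / (m%:R + 1)).
    by rewrite /kappa; field; rewrite !gt_eqF // ltr_wpDl.
  by rewrite ler_piMr ?divr_ge0 ?(ltW eta0) // ler_pdivrMr ?ltr_wpDl // mul1r lerDl.
have K2 : K * eta1 = eta / 2 by rewrite /eta1; field; rewrite gt_eqF.
apply: (@le_trans _ _ (eps * (m%:R * kappa) + K * eta1)); last by lra.
have k0 : 0 <= kappa^-1 by rewrite invr_ge0 ltW.
have t1 : m%:R * (m%:R * d) <= m%:R * m%:R * eta1 by rewrite mulrA ler_wpM2l // mulr_ge0.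
have t2 : (4 * m%:R + r%:R) * d <= (4 * m%:R + r%:R) * eta1.
  by rewrite ler_wpM2l // addr_ge0 // mulr_ge0.
have t3 : m%:R * (kappa^-1 * (4 * eta1 + (4 * m%:R + r%:R) * d)) <=
    m%:R * (kappa^-1 * (4 + (4 * m%:R + r%:R))) * eta1.
  by rewrite -!mulrA !ler_wpM2l // [leRHS]mulrDl lerD2l.
have := ler_wpM2l (ltW eps0) (lerD t1 t3); rewrite /K; lra.
Qed.

(** * Extracting a matching from the rounds *)

Definition matching (V E : finType) (inc : E -> {set V}) (M : {set E}) :=
  {in M &, forall e e', e != e' -> [disjoint inc e & inc e']}.

Section Matching.
Variables (R : realType) (V E : finType) (inc : E -> {set V}) (D eps : R).
Hypotheses (D_gt0 : 0 < D) (eps_ge0 : 0 <= eps).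

Definition rivals (A : {set V}) (e : E) : {set E} :=
  [set e' | [&& e' != e, inc e' \subset A & ~~ [disjoint inc e & inc e']]].

(** Only these edges enter the matching, although every picked live edge kills its vertices. *)
Definition accepted (A : {set V}) (X : {set E}) : {set E} :=
  [set e in X | (inc e \subset A) && [disjoint X & rivals A e]].

Definition mean_accepted (A : {set V}) : R :=
  \sum_X bernoulli_weight (pick_prob D eps) X * #|accepted A X|%:R.

Lemma le_mean_bernoulli (g : {set E} -> R) :
  exists X, \sum_X bernoulli_weight (pick_prob D eps) X * g X <= g X.
Proof.
case: (Order.TotalTheory.arg_maxP g (isT : xpredT (set0 : {set E}))) => X _ Xmax.
exists X; rewrite -[leRHS]mul1r -(sum_bernoulli_weight E (pick_prob D eps)) mulr_suml.
apply: ler_sum => Y _; apply: ler_wpM2l (Xmax Y isT).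
by rewrite bernoulli_weight_ge0 // pick_prob_itv.
Qed.

(** The rounds are derandomised one by one: [le_mean_bernoulli] gives an [X] for which the accepted
    edges plus the expected later gain reach the mean. Later edges lie in [survivors], so they avoid
    the accepted ones. *)
Lemma nibble_matching T (A : {set V}) : (forall e, inc e != set0) ->
  exists M : {set E}, [/\ forall e, e \in M -> inc e \subset A,
    matching inc M &
    \sum_(j < T) iter j (nibble inc D eps) mean_accepted A <= #|M|%:R].
Proof.
move=> inc_n0; elim: T A => [|T IHT] A.
  by exists set0; split=> [e|e e'|]; rewrite ?inE ?big_ord0 ?cards0.
rewrite big_ord_recl /=.
have -> : mean_accepted A + \sum_(i < T) nibble inc D eps (iter i (nibble inc D eps) mean_accepted) A
  = \sum_X bernoulli_weight (pick_prob D eps) X * (#|accepted A X|%:R +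
     \sum_(i < T) iter i (nibble inc D eps) mean_accepted (survivors inc A X)).
  rewrite exchange_big -big_split /=; apply: eq_bigr => X _.
  by rewrite mulrDr mulr_sumr.
have [X leX] := le_mean_bernoulli (fun X => #|accepted A X|%:R +
     \sum_(i < T) iter i (nibble inc D eps) mean_accepted (survivors inc A X)).
have [M [MA Mm leM]] := IHT (survivors inc A X).
have accM e e' : e \in accepted A X -> e' \in M -> [disjoint inc e & inc e'].
  rewrite inE => /and3P[eX eA _] /MA; rewrite subsetD => /andP[_].
  rewrite disjoint_sym; apply: disjointWl.
  by apply: (bigcup_max e); rewrite ?eX.
exists (accepted A X :|: M); split=> [e||].
- rewrite !inE => /orP[/and3P[]//|/MA]; rewrite subsetD.
  by case/andP.
- move=> e e' /setUP[] eX /setUP[] e'X ee'; last exact: Mm.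
  + move: eX e'X; rewrite !inE => /and3P[eX eA dX] /and3P[e'X e'A _].
    by apply/contraT => nd; have := disjointFr dX e'X; rewrite inE eq_sym ee' e'A nd.
  + exact: accM.
  + by rewrite disjoint_sym; exact: accM.
- apply: le_trans leX _; rewrite cardsU (_ : _ :&: M = set0).
    by rewrite cards0 subn0 natrD lerD2l.
  apply/setP => e; rewrite in_set0; apply/negP => /setIP[eX eM].
  have := accM _ _ eX eM; rewrite -setI_eq0 setIid.
  by apply/negP; exact: inc_n0.
Qed.

Variable r : nat.
Hypotheses (inc_le : forall e, (#|inc e| <= r)%N)
  (deg_le : forall v, #|[set e | v \in inc e]|%:R <= D).

Lemma card_rivals_le (A : {set V}) e : #|rivals A e|%:R <= r%:R * D.
Proof.
apply: (@le_trans _ _ (\sum_(v in inc e) #|[set e' | v \in inc e']|%:R)).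
  rewrite -natr_sum ler_nat.
  apply: (@leq_trans #|\bigcup_(v in inc e) [set e' | v \in inc e']|).
    apply/subset_leq_card/subsetP => e'; rewrite inE => /and3P[_ _].
    move=> /pred0Pn[v /andP[/= ve ve']].
    by apply/bigcupP; exists v => //; rewrite inE.
  elim/big_rec2: _ => [|v B n _ le]; first by rewrite cards0.
  by apply: leq_trans (leq_card_setU _ _) _; rewrite leq_add2l.
apply: (@le_trans _ _ (\sum_(v in inc e) D)).
  by apply: ler_sum => v _; apply: deg_le.
rewrite sumr_const -[leLHS]mulr_natl ler_wpM2r ?(ltW D_gt0) //.
by rewrite ler_nat.
Qed.

(** A live edge is accepted when it is picked and none of its rivals is. There are at most [r * D]
    rivals, all unpicked with probability at least [expR (- (eps * r))]. *)
Lemma mean_accepted_ge (A : {set V}) :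
  pick_prob D eps * expR (- (eps * r%:R)) * \sum_e ind R (inc e) A
    <= mean_accepted A.
Proof.
rewrite /mean_accepted.
have -> : \sum_X bernoulli_weight (pick_prob D eps) X * #|accepted A X|%:R =
  \sum_e ind R (inc e) A * \sum_X bernoulli_weight (pick_prob D eps) X *
    ((e \in X) && [disjoint X & rivals A e])%:R.
  under [RHS]eq_bigr => e _ do rewrite mulr_sumr.
  rewrite exchange_big /=; apply: eq_bigr => X _.
  rewrite -sum1_card natr_sum mulr_sumr big_mkcond /=; apply: eq_bigr => e _.
  rewrite inE mulrCA /ind -natrM mulnb andbCA.
  by case: ifP; rewrite ?mulr0.
rewrite mulr_sumr; apply: ler_sum => e _.
rewrite sum_bernoulli_weight_mem_disjoint ?inE ?eqxx // expr_pick_prob.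
rewrite [leLHS]mulrC ler_wpM2l ?ler0n // ler_wpM2l //.
  by case/andP: (pick_prob_itv D_gt0 eps_ge0).
rewrite ler_expR lerN2 ler_wpM2l // mulrC ler_pdivrMr //.
exact: card_rivals_le.
Qed.

Lemma pick_prob_ge : eps / D * expR (- (eps / D)) <= pick_prob D eps.
Proof.
have := expR_ge1Dx (eps / D); have := expRxMexpNx_1 (eps / D).
have := expR_ge0 (- (eps / D)); rewrite /pick_prob.
by nra.
Qed.

(** Multiplying [mean_link] by the factor at [v] completes each product to a whole edge, so at most
    [D] terms equal to [c] are summed and divided by [D]; then [1 - x <= expR (- x)] applies. *)
Lemma live_limS_ge j v c : 0 <= c ->
  (forall e, \prod_(u in inc e) live_lim inc D eps j u = c) ->
  live_lim inc D eps j v - eps * c <= live_lim inc D eps j.+1 v.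
Proof.
move=> c0 prodc; have /andP[f0 f1] := live_lim_itv inc D_gt0 eps_ge0 j v.
have fmean : live_lim inc D eps j v * mean_link inc D (live_lim inc D eps j) v <= c.
  rewrite /mean_link mulrCA mulr_sumr (eq_bigr (fun=> c)) => [|e ve].
    apply: le_trans (ler_norm _) _; apply: (sum_deg_le D_gt0 deg_le) => // e _.
    by rewrite ger0_norm.
  by rewrite -(prodc e) [RHS](big_setD1 v).
have := ler_wpM2l f0 (expR_ge1Dx (- (eps * mean_link inc D (live_lim inc D eps j) v))).
have := ler_wpM2l eps_ge0 fmean.
by rewrite /=; set x := expR _; nra.
Qed.

Lemma live_lim_ge j v (c : nat -> R) : (forall i, 0 <= c i) ->
  (forall i e, \prod_(u in inc e) live_lim inc D eps i u = c i) ->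
  1 - eps * (\sum_(i < j) c i) <= live_lim inc D eps j v.
Proof.
move=> c0 prodc; elim: j => [|j IHj]; first by rewrite big_ord0 mulr0 subr0.
apply: le_trans (live_limS_ge v (c0 j) (prodc j)).
by rewrite big_ord_recr /= mulrDr; lra.
Qed.

(* If the running sum were below [1 - rho], every vertex would stay live with
   probability at least [rho], so each round would add at least [eps * rho ^+ r]. *)
Lemma live_lim_sum_ge T (c : nat -> R) (rho : R) : 0 < rho <= 1 ->
  (forall i, 0 <= c i) ->
  (forall i e, \prod_(u in inc e) live_lim inc D eps i u = c i) ->
  1 <= T%:R * (eps * rho ^+ r) -> E ->
  1 - rho <= eps * \sum_(j < T) c j.
Proof.
move=> /andP[rho0 rho1] c0 prodc T_large e.
rewrite leNgt; apply/negP => small.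
have cj (j : 'I_T) : rho ^+ r <= c j.
  rewrite -(prodc j e); apply: (@le_trans _ _ (\prod_(u in inc e) rho)).
    by rewrite prodr_const ler_wiXn2l // ltW.
  apply: ler_prod => u _; rewrite (ltW rho0) /=.
  apply: le_trans _ (live_lim_ge j u c0 prodc).
  suff : eps * \sum_(i < j) c i <= eps * \sum_(i < T) c i by lra.
  rewrite ler_wpM2l // -!(big_mkord xpredT) (big_cat_nat (leq0n j) (ltnW (ltn_ord j))) /=.
  by rewrite lerDl sumr_ge0.
have : eps * \sum_(j < T) rho ^+ r <= eps * \sum_(j < T) c j.
  by rewrite ler_wpM2l // ler_sum.
by rewrite sumr_const card_ord -[X in eps * X]mulr_natl; lra.
Qed.

End Matching.

(** * Near-perfect matchings in edge-transitive hypergraphs *)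

Definition edge_transitive (V E : finType) (inc : E -> {set V}) :=
  forall e e' : E, exists sV : V -> V, exists sE : E -> E,
    [/\ injective sV, injective sE,
        forall g, inc (sE g) = sV @: inc g & sE e = e'].

(** The recursion refers only to incidences, and [sV] and [sE], being injective on finite types, are
    bijections that preserve them. *)
Lemma live_lim_aut (R : realType) (V E : finType) (inc : E -> {set V}) (D eps : R)
    (sV : V -> V) (sE : E -> E) :
  injective sV -> injective sE -> (forall g, inc (sE g) = sV @: inc g) ->
  forall j v, live_lim inc D eps j (sV v) = live_lim inc D eps j v.
Proof.
move=> sV_inj sE_inj incE; elim=> [//|j IHj] v /=; rewrite IHj.
do 4 congr (_ * _) || congr (- _) || congr (expR _).
rewrite /mean_link; congr (_ * _).
rewrite (reindex_inj sE_inj) /=; apply: eq_big => [e|e ve].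
  by rewrite incE mem_imset.
have -> : inc (sE e) :\ sV v = sV @: (inc e :\ v).
  apply/setP => u; rewrite incE !inE; apply/andP/imsetP.
    move=> [uv /imsetP[u' u'e uE]]; exists u' => //.
    by rewrite !inE u'e andbT; apply: contraNneq uv => <-; rewrite uE.
  move=> [u']; rewrite !inE => /andP[uv u'e] ->.
  by rewrite (inj_eq sV_inj) uv mem_imset.
rewrite big_imset /=; last by move=> ? ? _ _; apply: sV_inj.
by apply: eq_bigr => u _; apply: IHj.
Qed.

(** Round [j] gains about [eps * c j * #|E| / D] edges in expectation, and the [eps * c j] sum to
    nearly 1 by [live_lim_sum_ge]. The loss [eta] is split into three parts [rho]: collisions within
    a round, stopping after [T] rounds, and the error of the mean-field approximation. *)
Theorem near_perfect_matching (R : realType) (r : nat) (eta : R) : 0 < eta ->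
  exists2 delta : R, 0 < delta &
  forall (V E : finType) (inc : E -> {set V}) (D : R), 1 <= D ->
    edge_transitive inc ->
    (forall e, inc e != set0) -> (forall e, (#|inc e| <= r)%N) ->
    (forall v, #|[set e | v \in inc e]|%:R <= D) ->
    (forall u v, u != v ->
       #|[set e | (u \in inc e) && (v \in inc e)]|%:R <= delta * D) ->
  exists2 M : {set E}, matching inc M & (1 - eta) * (#|E|%:R / D) <= #|M|%:R.
Proof.
move=> eta0; pose rho := Num.min (eta / 3) (3^-1 : R).
have rho0 : 0 < rho by rewrite lt_min divr_gt0 //= invr_gt0 ltr0n.
have rho_eta : 3 * rho <= eta.
  by have : rho <= eta / 3 by [rewrite /rho ge_min lexx]; lra.
have rho3 : 3 * rho <= 1.
  by have : rho <= 3^-1 by [rewrite /rho ge_min lexx orbT]; lra.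
have r1 : 0 < r%:R + 1 :> R by rewrite ltr_wpDl.
(* With [eps * (r + 1) = rho], collisions and the gap between [pick_prob] and [eps / D] leave a
   factor of at least [1 - rho]. *)
pose eps := rho / (r%:R + 1).
have eps0 : 0 < eps by rewrite divr_gt0.
have epsr : eps * r%:R + eps = rho by rewrite /eps; field; rewrite gt_eqF.
have step0 : 0 < eps * rho ^+ r by rewrite mulr_gt0 // exprn_gt0.
pose T := Num.bound (eps * rho ^+ r)^-1.
have T_large : 1 <= T%:R * (eps * rho ^+ r).
  rewrite -ler_pdivrMr // div1r ltW //; apply: archi_boundP.
  by rewrite invr_ge0 ltW.
(* Over all rounds the approximation error is [T * eps * eta1], at most [rho]. *)
pose eta1 := rho / (T%:R * eps + 1).
have Te : 0 < T%:R * eps + 1 by rewrite ltr_wpDl // mulr_ge0 // ltW.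
have eta10 : 0 < eta1 by rewrite divr_gt0.
have eta1T : T%:R * eps * eta1 <= rho.
  by rewrite /eta1 mulrA ler_pdivrMr // mulrC ler_wpM2l ?(ltW rho0) //; lra.
have [delta delta0 approx] := live_prob_approx r T r eps0 eta10.
exists delta => // V E inc D D1 trans inc_n0 incr deg codeg.
have D0 : 0 < D by exact: lt_le_trans D1.
have [e0 _|noE] := pickP E; last first.
  exists set0 => [e|]; first by rewrite inE.
  by rewrite (eq_card0 noE) mul0r mulr0 cards0.
pose c j := \prod_(u in inc e0) live_lim inc D eps j u.
have prodc j e : \prod_(u in inc e) live_lim inc D eps j u = c j.
  have [sV [sE [sV_inj sE_inj incE <-]]] := trans e0 e.
  rewrite incE big_imset /=; last by move=> ? ? _ _; apply: sV_inj.
  by apply: eq_bigr => u _; apply: (live_lim_aut _ _ sV_inj sE_inj).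
have c0 j : 0 <= c j.
  by apply: prodr_ge0 => u _; case/andP: (live_lim_itv inc D0 (ltW eps0) j u).
have [M [_ Mm leM]] := nibble_matching D0 (ltW eps0) T setT inc_n0.
exists M => //; apply: le_trans leM.
have rho01 : 0 < rho <= 1 by rewrite rho0; lra.
have sumc := live_lim_sum_ge D0 (ltW eps0) incr deg rho01 c0 prodc T_large e0.
set p := pick_prob D eps; set x := expR (- (eps * r%:R)).
have p0 : 0 <= p by case/andP: (pick_prob_itv D0 (ltW eps0)).
have x0 : 0 <= x by exact: expR_ge0.
have round (j : 'I_T) : p * x * (#|E|%:R * (c j - eta1)) <=
    iter j (nibble inc D eps) (mean_accepted inc D eps) setT.
  have := le_iter_nibble inc D0 (ltW eps0) j setT
    (mean_accepted_ge D0 (ltW eps0) incr deg).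
  apply: le_trans; rewrite iter_nibbleZ iter_nibble_sum ler_wpM2l ?mulr_ge0 //.
  rewrite -sum1_card natr_sum mulr_suml; apply: ler_sum => e _; rewrite mul1r.
  have := approx _ _ inc D D0 incr deg codeg j (inc e) (ltnW (ltn_ord j)) (incr e).
  by rewrite prodc ler_norml /live_prob => /andP[? _]; lra.
apply: le_trans (ler_sum _ (fun j _ => round j)).
rewrite -!mulr_sumr sumrB sumr_const card_ord -[eta1 *+ T]mulr_natl.
have px : (1 - rho) * (eps / D) <= p * x.
  have e1 := pick_prob_ge D eps.
  have eD : eps / D <= eps by rewrite ler_pdivrMr // ler_peMr // ltW.
  have e2 : expR (- eps) <= expR (- (eps / D)) by rewrite ler_expR lerN2.
  have e3 : 1 - rho <= expR (- eps) * x.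
    rewrite -expRD; apply: le_trans (expR_ge1Dx _) => //.
    by rewrite -epsr; lra.
  have ed0 : 0 <= eps / D by rewrite divr_ge0 // ltW.
  have e4 := ler_wpM2l ed0 e3.
  have e5 := ler_wpM2r x0 (ler_wpM2l ed0 e2).
  have e6 := ler_wpM2r x0 e1.
  by rewrite -/p in e6; lra.
have s2 : 1 - 2 * rho <= eps * (\sum_(j < T) c j - T%:R * eta1) by lra.
have N0 : 0 <= #|E|%:R / D :> R by rewrite divr_ge0 // ltW.
have s0 : 0 <= \sum_(j < T) c j - T%:R * eta1.
  by rewrite -(pmulr_rge0 _ eps0); lra.
have := ler_wpM2r (mulr_ge0 (ler0n R #|E|) s0) px; apply: le_trans.
have -> : (1 - rho) * (eps / D) * (#|E|%:R * (\sum_(j < T) c j - T%:R * eta1)) =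
  (1 - rho) * (eps * (\sum_(j < T) c j - T%:R * eta1)) * (#|E|%:R / D).
  by field; rewrite gt_eqF.
apply: ler_wpM2r => //.
have := ler_wpM2l (_ : 0 <= 1 - rho) s2; have := mulr_ge0 (ltW rho0) (ltW rho0).
by nra.
Qed.

(** * Counting words *)

Local Close Scope ring_scope.

(** Induction on [#|A|], splitting by the symbol at a point [a] of [A]. Freezing [y] to [v] off [A]
    lets [a] leave [A] with its symbol recorded in [v']. Multiplying by the factorials avoids
    division. *)
Lemma card_fun_counts (T K : finType) (A : {set T}) (v : {ffun T -> K}) (k : K -> nat) :
  \sum_c k c = #|A| ->
  #|[set y : {ffun T -> K} | [forall i, (i \notin A) ==> (y i == v i)]
      && [forall c, #|[set i in A | y i == c]| == k c]]| * \prod_c (k c)`!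
  = #|A|`!.
Proof.
have [n cardA] : exists n, #|A| = n by exists #|A|.
elim: n A v k cardA => [|n IHn] A v k cardA sumk.
  have k0 c : k c = 0 by apply/eqP; rewrite -leqn0 -cardA -sumk (bigD1 c) ?leq_addr.
  rewrite big1 => [|c _]; last by rewrite k0.
  have A0 : A = set0 by apply/eqP; rewrite -cards_eq0 cardA.
  rewrite muln1 cardA (_ : [set _ | _] = [set v]) ?cards1 //.
  apply/setP => y; rewrite !inE A0; apply/andP/eqP => [[/forallP yv _]|->].
    by apply/ffunP => i; have := yv i; rewrite in_set0 => /eqP.
  split; first by apply/forallP => i; rewrite eqxx implybT.
  by apply/forallP => c; rewrite k0 cards_eq0; apply/eqP/setP => i; rewrite !inE.
have /card_gt0P[a aA] : 0 < #|A| by rewrite cardA.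
have cardAa : #|A :\ a| = n by move: cardA; rewrite (cardsD1 a) aA => -[].
have cntA (y : {ffun T -> K}) c : #|[set i in A | y i == c]| =
    (y a == c) + #|[set i in A :\ a | y i == c]|.
  rewrite (cardsD1 a) inE aA; congr (_ + #|pred_of_set _|).
  by apply/setP => i; rewrite !inE andbA.
rewrite -sum1_card (partition_big (fun y : {ffun T -> K} => y a) xpredT) //=.
rewrite big_distrl /= cardA factS -[n.+1]cardA -sumk big_distrl /=; apply: eq_bigr => c _.
rewrite sum1dep_card; case kc : (k c) => [|m].
  rewrite mul0n (_ : [set _ | _] = set0) ?cards0 ?mul0n //.
  apply/setP => y; rewrite !inE; apply/negP => /andP[/andP[_ /forallP/(_ c)]].
  by rewrite cntA kc => /eqP cnt0 /eqP ya; rewrite ya eqxx in cnt0.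
pose v' := [ffun i => if i == a then c else v i]; pose k' c' := k c' - (c' == c).
have sumk' : \sum_c' k' c' = #|A :\ a|.
  apply: succn_inj; rewrite cardAa -cardA -sumk -addn1.
  rewrite (bigD1 c) // [RHS](bigD1 c) //= /k' eqxx addnAC subnK ?kc //.
  by congr (_ + _); apply: eq_bigr => c' /negPf->; rewrite subn0.
rewrite -cardAa -(IHn _ v' k' cardAa sumk') (bigD1 c) //= kc factS.
rewrite [in RHS](bigD1 c) //= {2}/k' eqxx kc subn1 /=.
rewrite (eq_bigr (fun c' => (k' c')`!)) => [|c' /negPf c'c]; last first.
  by rewrite /k' c'c subn0.
rewrite (_ : [set _ | _] = [set y : {ffun T -> K} |
    [forall i, (i \notin A :\ a) ==> (y i == v' i)]
    && [forall c', #|[set i in A :\ a | y i == c']| == k' c']]).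
  by rewrite -!mulnA mulnCA; congr (_ * _); rewrite mulnCA.
apply/setP => y; rewrite !inE.
apply/andP/andP => [[/andP[/forallP yv /forallP yk] /eqP ya]|[/forallP yv /forallP yk]].
  split; apply/forallP.
    move=> i; rewrite !inE negb_and negbK ffunE; have [->|_] /= := eqVneq i a.
      by rewrite ya.
    exact: yv.
  by move=> c'; have := yk c'; rewrite cntA ya /k' (eq_sym c); case: (c' == c) => /=; lia.
have ya : y a = c by have := yv a; rewrite !inE eqxx ffunE eqxx => /eqP.
rewrite ya eqxx; split=> //; apply/andP; split; apply/forallP.
  move=> i; apply/implyP => iA; have := yv i; rewrite !inE negb_and iA orbT ffunE.
  by have [ia|//] := eqVneq i a; rewrite ia aA in iA.
move=> c'; have := yk c'; rewrite cntA ya /k' (eq_sym c).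
by have [->|_] := eqVneq c' c; rewrite ?kc /=; lia.
Qed.

Lemma prod_fact_dvdn (ks : seq nat) : \prod_(k <- ks) k`! %| (sumn ks)`!.
Proof.
elim: ks => [|k ks IHks]; first by rewrite big_nil.
rewrite big_cons /= -(bin_fact (leq_addr (sumn ks) k)) addKn.
by rewrite dvdn_mull // dvdn_mul.
Qed.

Lemma multinom_fact (ks : seq nat) :
  multinom (sumn ks) ks * \prod_(k <- ks) k`! = (sumn ks)`!.
Proof. by rewrite divnK // prod_fact_dvdn. Qed.

Lemma multinom_ord_fact (m s : nat) (k : 'I_m -> nat) : \sum_i k i = s ->
  multinom s [seq k i | i : 'I_m] * \prod_i (k i)`! = s`!.
Proof.
move=> <-; have -> : \sum_i k i = sumn [seq k i | i : 'I_m].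
  by rewrite sumnE big_map big_enum.
by rewrite -[RHS]multinom_fact [in RHS]big_map big_enum.
Qed.

Lemma multinom_le_fmax (m s : nat) (wbar : {ffun 'I_m -> nat}) (k : 'I_m -> nat) :
  \sum_i k i = s -> (forall i, k i <= wbar i) ->
  multinom s [seq k i | i : 'I_m] <= fmax wbar s.
Proof.
move=> sumk kw; have ks i : k i < s.+1 by rewrite ltnS -sumk (bigD1 i) ?leq_addr.
pose sbar := [ffun i => (inord (k i) : 'I_s.+1)].
have sbarE i : sbar i = k i :> nat by rewrite ffunE inordK.
have -> : [seq k i | i : 'I_m] = [seq nat_of_ord (sbar i) | i : 'I_m].
  by apply: eq_map => i; rewrite sbarE.
apply: (leq_bigmax_cond (F := fun sb : {ffun 'I_m -> 'I_s.+1} =>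
  multinom s [seq nat_of_ord (sb i) | i : 'I_m])).
rewrite /admissible; apply/andP; split.
  by apply/eqP; rewrite -[RHS]sumk; apply: eq_bigr => i _.
by apply/forallP => i; rewrite sbarE.
Qed.

(** * Words of a given composition and their extensions *)

Section Words.
Variables (n q : nat) (wbar : {ffun 'I_q.+1.-1 -> nat}).
Local Notation word := {ffun 'I_n -> 'I_q.+1}.
Local Notation w := (\sum_i wbar i).

Definition supp (x : word) : {set 'I_n} := [set k | x k != ord0].

(** The smaller word comes first: [v] arises from [x] by setting some symbols to 0. *)
Definition extends (v x : word) : bool := [forall k, (v k != ord0) ==> (x k == v k)].

Definition restrict (x : word) (W : {set 'I_n}) : word :=
  [ffun i => if i \in W then x i else ord0].

Lemma extends_restrict (x : word) (W : {set 'I_n}) : extends (restrict x W) x.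
Proof. by apply/forallP => i; rewrite ffunE; case: ifP; rewrite ?eqxx ?implybT. Qed.

Lemma supp_restrict (x : word) (W : {set 'I_n}) : W \subset supp x ->
  supp (restrict x W) = W.
Proof.
move=> /subsetP Wx; apply/setP => i; rewrite inE ffunE.
by case: ifP => [/Wx|]; rewrite ?inE // eqxx.
Qed.

Definition symbol_count (c : 'I_q.+1) : nat :=
  if unlift ord0 c is Some i then wbar i else n - w.

Lemma symbol_count0 : symbol_count ord0 = n - w.
Proof. by rewrite /symbol_count unlift_none. Qed.

Lemma symbol_count_lift i : symbol_count (lift ord0 i) = wbar i.
Proof. by rewrite /symbol_count liftK. Qed.

Lemma sum_symbol_count : w <= n -> \sum_c symbol_count c = n.
Proof.
move=> wn; rewrite big_ord_recl symbol_count0.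
by rewrite -[RHS](subnK wn); congr (_ + _); apply: eq_bigr => i _; apply: symbol_count_lift.
Qed.

Lemma composition_ofE (x : word) i :
  composition_of x i = #|[set k | x k == lift ord0 i]|.
Proof.
by rewrite ffunE; apply: eq_card => k; rewrite !inE.
Qed.

Lemma sum_card_fiber (T : finType) (A : {set T}) (x : T -> 'I_q.+1) :
  \sum_c #|[set k in A | x k == c]| = #|A|.
Proof.
rewrite -sum1_card (partition_big x xpredT) //=; apply: eq_bigr => c _.
by rewrite sum1dep_card.
Qed.

Lemma symbol_countP (x : word) : composition_of x = wbar ->
  forall c, #|[set k | x k == c]| = symbol_count c.
Proof.
move=> xw; have cnt i : #|[set k | x k == lift ord0 i]| = wbar i.
  by rewrite -xw composition_ofE.
move=> c; rewrite /symbol_count; case: unliftP => [i ->|->]; first exact: cnt.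
have := sum_card_fiber setT x; rewrite cardsT card_ord big_ord_recl => sumx.
have sumE : \sum_(i < q) #|[set k in setT | x k == lift ord0 i]| = w.
  by apply: eq_bigr => i _; rewrite -cnt; apply: eq_card => k; rewrite !inE.
have -> : #|[set k | x k == ord0]| = #|[set k in setT | x k == ord0]|.
  by apply: eq_card => k; rewrite !inE.
by rewrite -[LHS](addnK w) -sumE sumx.
Qed.

Lemma card_supp (x : word) : composition_of x = wbar -> #|supp x| = w.
Proof.
move=> xw; rewrite -(sum_card_fiber (supp x) x) big_ord_recl.
rewrite (_ : [set _ in _ | _] = set0) ?cards0; last first.
  by apply/setP => k; rewrite !inE; case: eqP.
apply: eq_bigr => i _; rewrite -xw composition_ofE; congr #|pred_of_set _|.
by apply/setP => k; rewrite !inE; case: (x k =P _) => [->|]; rewrite ?andbF.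
Qed.

Lemma card_words : w <= n ->
  #|[set x : word | composition_of x == wbar]|
  = multinom n ((n - w) :: [seq wbar i | i : 'I_q.+1.-1]).
Proof.
move=> wn; set ks := _ :: _.
have sumks : sumn ks = n.
  by rewrite /= sumnE big_map big_enum subnK.
have prodks : \prod_(k <- ks) k`! = \prod_c (symbol_count c)`!.
  rewrite big_cons big_map big_enum [RHS]big_ord_recl symbol_count0.
  by congr (_ * _); apply: eq_bigr => i _; rewrite symbol_count_lift.
have := multinom_fact ks; rewrite sumks prodks.
rewrite -{2}[n]card_ord -cardsT -(card_fun_counts (finfun (fun=> ord0)) (k
  := symbol_count)); last first.
  by rewrite cardsT card_ord sum_symbol_count.
move=> /eqP; rewrite eqn_pmul2r ?prodn_gt0 // => [/eqP->|c]; last exact: fact_gt0.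
congr #|pred_of_set _|; apply/setP => x; rewrite !inE.
have -> : [forall i, (i \notin [set: 'I_n]) ==> (x i == [ffun=> ord0] i)].
  by apply/forallP => i; rewrite inE.
apply/eqP/forallP => [xw c|xc].
  by rewrite -(symbol_countP xw); apply/eqP; apply: eq_card => k; rewrite !inE.
apply/ffunP => i; rewrite composition_ofE; have := xc (lift ord0 i).
rewrite symbol_count_lift => /eqP <-.
by apply: eq_card => k; rewrite !inE.
Qed.

(** All these words carry the same symbols off [supp v], with multiplicities [k], so a multinomial
    coefficient of [n - s] bounds their number. It splits into the choice of [w - s] new support
    positions and a multinomial coefficient of [w - s], at most [fmax]. *)
Lemma card_extensions (s : nat) (v : word) : w <= n -> s <= w -> #|supp v| = s ->
  #|[set x : word | (composition_of x == wbar) && extends v x]|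
    <= 'C(n - s, w - s) * fmax wbar (w - s).
Proof.
move=> wn sw vs; set X := [set x | _].
have [->|[x0]] := set_0Vmem X; first by rewrite cards0.
rewrite inE => /andP[/eqP x0w /forallP x0v].
pose A := ~: supp v; pose k c := #|[set i in A | x0 i == c]|.
have cardA : #|A| = n - s by rewrite cardsCs setCK card_ord vs.
have sumk : \sum_c k c = #|A| by exact: sum_card_fiber.
have split_count x c : extends v x ->
    #|[set i | x i == c]| = #|[set i in A | x i == c]| + #|[set i in supp v | v i == c]|.
  move=> /forallP xv; rewrite -(cardsID A [set i | x i == c]); congr addn; apply: eq_card => i.
    by rewrite !inE andbC.
  rewrite !inE negbK; case v0 : (v i != ord0) => //=.
  by have := xv i; rewrite v0 => /eqP->.
have XA : X \subset [set y : word | [forall i, (i \notin A) ==> (y i == v i)]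
      && [forall c, #|[set i in A | y i == c]| == k c]].
  apply/subsetP => x; rewrite !inE => /andP[/eqP xw xv].
  apply/andP; split; apply/forallP => i.
    by rewrite !inE negbK; move/forallP: xv.
  have := symbol_countP xw i; rewrite -(symbol_countP x0w i).
  rewrite !split_count //; last exact/forallP.
  by move=> /addIn->.
apply: leq_trans (subset_leq_card XA) _.
have := card_fun_counts v sumk; set N := #|pred_of_set _|; rewrite cardA.
have k0 : k ord0 = n - w.
  rewrite -symbol_count0 -(symbol_countP x0w); apply: eq_card => i; rewrite !inE negbK.
  have [xi0|] := eqVneq (x0 i) ord0; rewrite ?andbF // andbT.
  by have := x0v i; rewrite xi0; case: (v i =P ord0) => [->|] //= vi /eqP /esym.
have kw i : k (lift ord0 i) <= wbar i.
  rewrite -x0w composition_ofE; apply/subset_leq_card/subsetP => a.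
  by rewrite !inE => /andP[].
have ks : \sum_i k (lift ord0 i) = w - s.
  move: sumk wn sw; rewrite big_ord_recl k0 cardA.
  by move: (\sum_i wbar i) (\sum_i k _) => a b; lia.
have := multinom_le_fmax ks kw; have := multinom_ord_fact ks.
set M := multinom _ _ => ME Mf.
rewrite big_ord_recl k0 -(@bin_fact (n - s) (w - s)); last by rewrite leq_sub2r.
rewrite -ME (_ : n - s - (w - s) = n - w); last first.
  by move: wn sw; move: (\sum_i wbar i) => a; lia.
set P := \prod_i _ => NE.
apply: (@leq_trans ('C(n - s, w - s) * M)); last by rewrite leq_mul2l Mf orbT.
rewrite -(@leq_pmul2r ((n - w)`! * P)); last first.
  by rewrite muln_gt0 fact_gt0 prodn_gt0 // => i; apply: fact_gt0.
by rewrite NE; apply: eq_leq; ring.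
Qed.

(** A word covering [W] extends its restriction to [W], and at most [q.+1 ^ s] words have support
    [W]. *)
Lemma card_cover (s : nat) (W : {set 'I_n}) : w <= n -> s <= w -> #|W| = s ->
  #|[set x : word | (composition_of x == wbar) && (W \subset supp x)]|
    <= q.+1 ^ s * ('C(n - s, w - s) * fmax wbar (w - s)).
Proof.
move=> wn sw Ws; pose Vs := [set v : word | supp v == W].
have cardVs : #|Vs| <= q.+1 ^ s.
  have := card_pffun_on (ord0 : 'I_q.+1) (mem W) predT.
  rewrite -Ws [#|mem W|]/= card_ord => <-;
    apply/subset_leq_card/subsetP => v; rewrite inE => /eqP vW.
  apply/pffun_onP; split=> //; apply/supportP => i; rewrite -vW inE negbK.
  by move/eqP.
apply: (@leq_trans #|\bigcup_(v in Vs) [set x : word | (composition_of x == wbar)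
  && extends v x]|).
  apply/subset_leq_card/subsetP => x; rewrite inE => /andP[xw Wx].
  apply/bigcupP; exists (restrict x W); first by rewrite inE supp_restrict.
  by rewrite inE xw extends_restrict.
apply: (@leq_trans (\sum_(v in Vs) 'C(n - s, w - s) * fmax wbar (w - s))).
  apply: (@leq_trans (\sum_(v in Vs) #|[set x : word | (composition_of x == wbar)
    && extends v x]|)).
    elim/big_rec2: _ => [|v B b _ le]; first by rewrite cards0.
    by apply: leq_trans (leq_card_setU _ _) _; rewrite leq_add2l.
  apply: leq_sum => v; rewrite inE => /eqP vW.
  by apply: card_extensions => //; rewrite vW.
by rewrite sum_nat_const leq_mul2r cardVs orbT.
Qed.

End Words.

(** * The hypergraph of words *)

Section Hypergraph.
Variables (n q t : nat) (wbar : {ffun 'I_q.+1.-1 -> nat}).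
Local Notation word := {ffun 'I_n -> 'I_q.+1}.
Local Notation w := (\sum_i wbar i).

Definition ccword := {x : word | composition_of x == wbar}.

(* The [t.+1]-sets make words with more than [t] common support positions
   conflict, whatever their symbols there. *)
Definition word_links (e : ccword) : {set word + {set 'I_n}} :=
  [set u : word + {set 'I_n} | match u with
           | inl v => (#|supp v| == t) && extends v (val e)
           | inr W => (#|W| == t.+1) && (W \subset supp (val e))
           end].

Lemma supp_extends (v x : word) : extends v x -> supp v \subset supp x.
Proof.
move=> /forallP vx; apply/subsetP => i; rewrite !inE => vi.
by have := vx i; rewrite vi => /eqP->.
Qed.

Lemma extends_inj (v v' x : word) : extends v x -> extends v' x ->
  supp v = supp v' -> v = v'.
Proof.
move=> /forallP vx /forallP vx' /setP vv'; apply/ffunP => i.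
move: (vx i) (vx' i) (vv' i); rewrite !inE.
case: (v i =P ord0) => [->|_]; case: (v' i =P ord0) => [->|_] //=.
by move=> /eqP<- /eqP<-.
Qed.

(** Among the links of one word, a link is determined by its kind and its set of positions, a subset
    of the support. *)
Lemma card_word_links (e : ccword) : #|word_links e| <= 2 * 2 ^ w.
Proof.
pose h (u : word + {set 'I_n}) : bool * {set 'I_n} :=
  match u with inl v => (false, supp v) | inr W => (true, W) end.
rewrite -(@card_in_imset _ _ h) => [|u u'].
  rewrite -[X in X * _]card_bool -(card_supp (eqP (valP e))) -card_powerset -cardsT -cardsX.
  apply/subset_leq_card/subsetP => _ /imsetP[[v|W] + ->]; rewrite !inE /=.
    by move=> /andP[_ /supp_extends].
  by case/andP.
case: u => [v|W]; case: u' => [v'|W']; rewrite !inE //=.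
  move=> /andP[_ ve] /andP[_ ve'] [vv']; congr inl; exact: extends_inj ve ve' vv'.
by move=> _ _ [->].
Qed.

Lemma word_links_neq0 (e : ccword) : t <= w -> word_links e != set0.
Proof.
rewrite -(card_supp (eqP (valP e))) => tw.
have /card_gt0P[W] : 0 < #|[set W : {set 'I_n} | (W \subset supp (val e)) && (#|W| == t)]|.
  by rewrite cards_draws bin_gt0.
rewrite inE => /andP[We Wt]; apply/set0Pn; exists (inl (restrict (val e) W)).
by rewrite inE supp_restrict // Wt extends_restrict.
Qed.

Lemma exists_perm_word (x y : word) : composition_of x = wbar -> composition_of y = wbar ->
  exists s : 'S_n, y = [ffun i => x (s i)].
Proof.
move=> xw yw; have : perm_eq (mktuple y) (mktuple x).
  apply/allP => c _ /=; apply/eqP.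
  have cnt (z : word) : composition_of z = wbar -> count_mem c (mktuple z)
    = symbol_count n wbar c.
    move=> zw; rewrite -(symbol_countP zw) count_map cardE [in RHS]/enum_mem size_filter -enumT.
    by apply: eq_count => i; rewrite /= inE.
  by rewrite !cnt.
case/tuple_permP => s ys; exists s; apply/ffunP => i; rewrite ffunE.
have /(congr1 (fun z => tnth z i)) : mktuple y
  = [tuple tnth (mktuple x) (s i) | i < n] by exact: val_inj.
by rewrite !tnth_mktuple.
Qed.

Definition permute_word (s : 'S_n) (x : word) : word := [ffun i => x (s i)].

Lemma composition_permute (s : 'S_n) (x : word) :
  composition_of (permute_word s x) = composition_of x.
Proof.
apply/ffunP => i; rewrite !ffunE.
rewrite -[RHS](card_preimset _ (@perm_inj _ s)).
by apply: eq_card => k; rewrite !inE ffunE.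
Qed.

Lemma supp_permute (s : 'S_n) (x : word) : supp (permute_word s x) = s @^-1: supp x.
Proof. by apply/setP => i; rewrite !inE ffunE. Qed.

Lemma extends_permute (s : 'S_n) (v x : word) :
  extends (permute_word s v) (permute_word s x) = extends v x.
Proof.
apply/forallP/forallP => vx i; last by rewrite !ffunE.
by have := vx (s^-1%g i); rewrite !ffunE permKV.
Qed.

Lemma permute_wordK (s : 'S_n) : cancel (permute_word s) (permute_word s^-1%g).
Proof. by move=> x; apply/ffunP => i; rewrite !ffunE permKV. Qed.

Lemma preim_permK (s : 'S_n) (W : {set 'I_n}) : s^-1%g @^-1: (s @^-1: W) = W.
Proof. by apply/setP => i; rewrite !inE permKV. Qed.

(** Permutations of the coordinates act on words by precomposition, hence on sets of positions by
    preimage, and carry any word to any other of the same composition. *)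
Lemma word_links_transitive : edge_transitive word_links.
Proof.
move=> e e'; have [s es] := exists_perm_word (eqP (valP e)) (eqP (valP e')).
pose sV (s : 'S_n) (u : word + {set 'I_n}) : word + {set 'I_n} :=
  match u with inl v => inl (permute_word s v) | inr W => inr (s @^-1: W) end.
have sVK (s' : 'S_n) : cancel (sV s') (sV s'^-1%g).
  by case=> [v|W] /=; rewrite ?permute_wordK ?preim_permK.
have sEP (g : ccword) : composition_of (permute_word s (val g)) == wbar.
  by rewrite composition_permute (valP g).
pose sE (g : ccword) : ccword := Sub (permute_word s (val g)) (sEP g).
have links g u : (sV s u \in word_links (sE g)) = (u \in word_links g).
  rewrite !inE; case: u => [v|W] /=.
    by rewrite supp_permute card_preimset ?extends_permute //; apply: perm_inj.
  rewrite supp_permute card_preimset; last exact: perm_inj.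
  congr (_ && _); apply/subsetP/subsetP => WS i.
    by move=> iW; have := WS (s^-1%g i); rewrite !inE permKV; apply.
  by rewrite inE => /WS; rewrite !inE.
exists (sV s), sE; split.
- exact: can_inj (sVK s).
- move=> g g' /(congr1 val) /= /(can_inj (permute_wordK s)); exact: val_inj.
- move=> g; apply/setP => u; have := sVK s^-1%g u; rewrite invgK => <-.
  by rewrite links mem_imset //; apply: can_inj (sVK s).
- by apply: val_inj; rewrite /= es.
Qed.

Lemma card_sig_pred (P : pred word) :
  #|[set e : ccword | P (val e)]| = #|[set x : word | (composition_of x == wbar) && P x]|.
Proof.
rewrite -(card_imset _ val_inj); apply: eq_card => x; apply/imsetP/idP.
  by move=> [e + ->]; rewrite !inE => ->; rewrite (valP e).
by rewrite inE => /andP[xw Px]; exists (Sub x xw); rewrite ?inE /=.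
Qed.

Definition cover_bound := q.+1 ^ t.+1 * ('C(n - t.+1, w - t.+1) * fmax wbar (w - t.+1)).

(** For [t = w] no support contains [t.+1] positions, which the factor [t < w] records; the
    truncated [w - t.+1] would leave a constant that is not small against the main degree. *)
Lemma card_cover_words (W : {set 'I_n}) : w <= n -> #|W| = t.+1 ->
  #|[set e : ccword | W \subset supp (val e)]| <= (t < w) * cover_bound.
Proof.
move=> wn Wt; rewrite (card_sig_pred (fun x => W \subset supp x)); case: ltnP => tw.
  by rewrite mul1n; apply: card_cover.
rewrite mul0n leqn0 cards_eq0; apply/eqP/setP => x; rewrite !inE.
apply/negP => /andP[/eqP xw /subset_leq_card]; rewrite (card_supp xw) Wt.
by rewrite leqNgt ltnS tw.
Qed.

Lemma word_links_deg (u : word + {set 'I_n}) : w <= n -> t <= w ->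
  #|[set e | u \in word_links e]|
    <= maxn ('C(n - t, w - t) * fmax wbar (w - t)) ((t < w) * cover_bound).
Proof.
move=> wn tw; case: u => [v|W]; rewrite leq_max; apply/orP; [left|right].
  have [vt|vt] := eqVneq #|supp v| t.
    apply: leq_trans (card_extensions wn tw vt); rewrite -(card_sig_pred (extends v)).
    by apply/subset_leq_card/subsetP => e; rewrite !inE => /andP[].
  rewrite (_ : [set _ | _] = set0) ?cards0 //.
  by apply/setP => e; rewrite !inE (negPf vt).
have [Wt|Wt] := eqVneq #|W| t.+1.
  apply: leq_trans (card_cover_words wn Wt).
  by apply/subset_leq_card/subsetP => e; rewrite !inE => /andP[].
rewrite (_ : [set _ | _] = set0) ?cards0 //.
by apply/setP => e; rewrite !inE (negPf Wt).
Qed.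

(** Two distinct links of one word together occupy at least [t.+1] positions: one of them is a
    [t.+1]-set, or both are [t]-subwords, whose supports differ by [extends_inj]. *)
Lemma word_links_codeg (u u' : word + {set 'I_n}) : w <= n -> u != u' ->
  #|[set e | (u \in word_links e) && (u' \in word_links e)]|
    <= (t < w) * cover_bound.
Proof.
move=> wn uu'.
suff [->|[W Wt WX]] : [set e | (u \in word_links e) && (u' \in word_links e)] = set0
    \/ exists2 W : {set 'I_n}, #|W| = t.+1 &
      [set e | (u \in word_links e) && (u' \in word_links e)]
        \subset [set e | W \subset supp (val e)].
- by rewrite cards0.
- exact: leq_trans (subset_leq_card WX) (card_cover_words wn Wt).
have [->|[e0 e0E]] := set_0Vmem [set e | (u \in word_links e) && (u' \in word_links e)].
  by left.
right; move: e0E; case: u u' uu' => [v|W] [v'|W'] uu'; last 2 first.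
- rewrite !inE => /andP[/andP[/eqP Wt _] _]; exists W => //.
  by apply/subsetP => e; rewrite !inE => /andP[/andP[]].
- rewrite !inE => /andP[/andP[/eqP Wt _] _]; exists W => //.
  by apply/subsetP => e; rewrite !inE => /andP[/andP[]].
- rewrite !inE => /andP[/andP[/eqP vt ve] /andP[/eqP vt' ve']].
  have nvv : supp v != supp v'.
    by apply: contraNneq uu' => vv'; rewrite (extends_inj ve ve' vv').
  have : t < #|supp v :|: supp v'|.
    rewrite ltnNge; apply: contraNN nvv => le.
    have vU : supp v = supp v :|: supp v'.
      by apply/eqP; rewrite eqEcard subsetUl vt.
    have vU' : supp v' = supp v :|: supp v'.
      by apply/eqP; rewrite eqEcard subsetUr vt'.
    by rewrite vU -vU'.
  move=> tU; have /card_gt0P[W] : 0 < #|[set W : {set 'I_n} |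
      (W \subset supp v :|: supp v') && (#|W| == t.+1)]| by rewrite cards_draws bin_gt0.
  rewrite inE => /andP[WU /eqP Wt]; exists W => //.
  apply/subsetP => e; rewrite !inE => /andP[/andP[_ xv] /andP[_ xv']].
  by apply: subset_trans WU _; rewrite subUset !supp_extends.
- rewrite !inE => /andP[_ /andP[/eqP Wt _]]; exists W' => //.
  by apply/subsetP => e; rewrite !inE => /andP[_ /andP[]].
Qed.

(* Two words that share neither a [t]-subword nor [t.+1] support positions agree
   on fewer than [t] support positions and have at most [t] common ones. *)
Lemma hamming_links (e e' : ccword) : [disjoint word_links e & word_links e'] ->
  0 < t /\ 2 * w < hamming (val e) (val e') + 2 * t.
Proof.
move=> dis; set x := val e; set y := val e'.
pose I := supp x :&: supp y; pose Ag := [set k in I | x k == y k].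
have disF u : u \in word_links e -> u \in word_links e' -> False.
  by move=> ue ue'; have := disjointFr dis ue; rewrite ue'.
have It : #|I| <= t.
  rewrite leqNgt; apply/negP => tI.
  have /card_gt0P[W] : 0 < #|[set W : {set 'I_n} | (W \subset I) && (#|W| == t.+1)]|.
    by rewrite cards_draws bin_gt0.
  rewrite inE subsetI => /andP[/andP[Wx Wy] Wt].
  by apply: (disF (inr W)); rewrite inE Wt.
have Agt : #|Ag| < t.
  rewrite ltnNge; apply/negP => tA.
  have /card_gt0P[W] : 0 < #|[set W : {set 'I_n} | (W \subset Ag) && (#|W| == t)]|.
    by rewrite cards_draws bin_gt0.
  rewrite inE => /andP[WA Wt].
  have WI : W \subset I.
    by apply: subset_trans WA _; apply/subsetP => k; rewrite inE => /andP[].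
  have Wx : W \subset supp x by apply: subset_trans WI (subsetIl _ _).
  have Wy : W \subset supp y by apply: subset_trans WI (subsetIr _ _).
  have xy : restrict x W = restrict y W.
    apply/ffunP => k; rewrite !ffunE; case: ifP => // /(subsetP WA).
    by rewrite inE => /andP[_ /eqP].
  apply: (disF (inl (restrict x W))); rewrite inE supp_restrict // Wt ?extends_restrict //.
  by rewrite /= xy extends_restrict.
(* At a position in the union of the supports, the words either differ or share a nonzero symbol. *)
have UE : #|supp x :|: supp y| <= hamming x y + #|Ag|.
  apply: leq_trans (leq_card_setU _ _); apply/subset_leq_card/subsetP => k.
  rewrite !inE; case: (x k =P y k) => [->|] //=; by rewrite orbb andbT andbb.
have := cardsUI (supp x) (supp y).
have -> : #|supp x| = w := card_supp (eqP (valP e)).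
have -> : #|supp y| = w := card_supp (eqP (valP e')).
(* Now [2 * w] is the size of the union plus that of [I], at most [hamming x y + (t - 1) + t]. *)
rewrite -/I; move: UE It Agt; move: (\sum_i wbar i) => a; lia.
Qed.

(** For [d = 2 * m + 1] one has [t = w - m], so [hamming_links] gives a distance above [2 * m]. When
    [d] exceeds [2 * w], truncation gives [t = 0], which [hamming_links] excludes as soon as two
    edges are disjoint. *)
Lemma matching_ccc (d : nat) (M : {set ccword}) : odd d -> t = (2 * w + 1 - d) %/ 2 ->
  matching word_links M -> #|M| <= max_ccc n d wbar.
Proof.
move=> dodd tE Mm; rewrite -(card_imset _ val_inj).
apply: (leq_bigmax_cond (F := fun C : {set word} => #|C|)).
apply/andP; split; apply/forallP => x; apply/implyP => /imsetP[e eM ->].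
  exact: (valP e).
apply/forallP => y; apply/implyP => /imsetP[e' e'M ->]; apply/implyP => ee'.
have ne : e != e' by apply: contraNneq ee' => ->.
have [t0] := hamming_links (Mm _ _ eM e'M ne).
have [m dE] : exists m, d = 2 * m + 1.
  by exists d./2; rewrite -{1}(odd_double_half d) dodd mul2n addnC.
move: tE t0; rewrite dE; move: (hamming _ _) (\sum_i wbar i) => h a tE.
by have := leq_trunc_div (2 * a + 1 - (2 * m + 1)) 2; rewrite -tE; lia.
Qed.

End Hypergraph.

(** * Estimates for large [n] *)

Section Asymptotics.
Variables (q : nat) (wbar : {ffun 'I_q.+1.-1 -> nat}).
Local Notation w := (\sum_i wbar i).

(** The identity [diag] trades the factor [n - t] for [w - t], so codegrees are smaller than the
    main degree by a factor of order [n]. *)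
Lemma cover_bound_le (n t : nat) : t < w -> 0 < fmax wbar (w - t) ->
  (n - t) * cover_bound n t wbar <=
    q.+1 ^ t.+1 * fmax wbar (w - t.+1) * w * ('C(n - t, w - t) * fmax wbar (w - t)).
Proof.
move=> tw f_gt0.
have diag : (n - t) * 'C(n - t.+1, w - t.+1) = (w - t) * 'C(n - t, w - t).
  by rewrite subnS mul_bin_diag subnSK.
rewrite /cover_bound; move: (fmax _ (w - t.+1)) => g.
have -> : (n - t) * (q.+1 ^ t.+1 * ('C(n - t.+1, w - t.+1) * g))
    = q.+1 ^ t.+1 * g * ((n - t) * 'C(n - t.+1, w - t.+1)) by ring.
rewrite diag -!mulnA !leq_mul // ?leq_subr // leq_pmulr //.
Qed.

Lemma max_ccc_lower (R : realType) (d : nat) (eta : R) (t := (2 * w + 1 - d) %/ 2) :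
  0 < d -> odd d -> (0 < eta)%R ->
  exists N : nat, forall n, N <= n ->
    ((1 - eta) * ((multinom n ((n - w)%N :: [seq wbar i | i : 'I_q.+1.-1]))%:R /
       ('C(n - t, w - t) * fmax wbar (w - t))%N%:R) <= (max_ccc n d wbar)%:R)%R.
Proof.
move=> d0 dodd eta0.
have tw : t <= w.
  rewrite /t; move: (\sum_i wbar i) => a.
  by have := leq_trunc_div (2 * a + 1 - d) 2; lia.
(* Division by 0 yields 0, so the lower bound is 0 in the first case. *)
have [f0|f_gt0] := posnP (fmax wbar (w - t)).
  by exists 0 => n _; rewrite f0 muln0 invr0 !mulr0.
have [delta delta0 pack] := near_perfect_matching (2 * 2 ^ w) eta0.
pose K := q.+1 ^ t.+1 * fmax wbar (w - t.+1) * w.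
(* The bound by [delta] serves the codegrees, the bound by 1 the degrees of the [t.+1]-sets. *)
pose m := (Num.min delta 1)%R.
have m0 : (0 < m)%R by rewrite lt_min delta0 ltr01.
have md : (m <= delta)%R by rewrite /m ge_min lexx.
have m1 : (m <= 1)%R by rewrite /m ge_min lexx orbT.
(* Large enough for [K <= (n - t) * m], which turns [cover_bound_le] into a bound by [m * D0]. *)
exists (w + t + Num.bound (K%:R / m : R)%R) => n nN.
have wn : w <= n by lia.
set D0 := 'C(n - t, w - t) * fmax wbar (w - t).
have D01 : 0 < D0 by rewrite muln_gt0 f_gt0 andbT bin_gt0 leq_sub2r.
have D1 : (1 <= D0%:R :> R)%R by rewrite ler1n.
have D_gt0 : (0 < D0%:R :> R)%R by rewrite ltr0n.
have cov : (((t < w) * cover_bound n t wbar)%N%:R <= m * D0%:R :> R)%R.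
  case: ltnP => [ltw|_]; last by rewrite mul0n mulr_ge0 // ltW.
  rewrite mul1n.
  have nt : (K%:R <= (n - t)%N%:R * m)%R.
    rewrite -ler_pdivrMr //; apply: ltW; apply: lt_le_trans (archi_boundP _) _.
      by rewrite divr_ge0 // ltW.
    by rewrite ler_nat leq_subRL ?(leq_trans tw) //;
      apply: leq_trans nN; rewrite -addnA leq_addl.
  have nt0 : (0 < (n - t)%N%:R :> R)%R by rewrite ltr0n subn_gt0 (leq_trans ltw).
  rewrite -(ler_pM2l nt0) mulrA.
  apply: le_trans (ler_wpM2r (ltW D_gt0) nt).
  by rewrite -!natrM ler_nat cover_bound_le.
have [|e|e|v|u v uv|M Mm] := pack _ (ccword n wbar) (@word_links n q t wbar) D0%:R%R D1.
- exact: word_links_transitive.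
- exact: word_links_neq0.
- exact: card_word_links.
- apply: (@le_trans _ _ (maxn D0 ((t < w) * cover_bound n t wbar))%N%:R%R).
    by rewrite ler_nat word_links_deg.
  rewrite /maxn; case: ifP => // _; apply: le_trans cov _.
  by rewrite ler_piMl // ltW.
- apply: (@le_trans _ _ (m * D0%:R)%R); last by rewrite ler_wpM2r // ltW.
  by apply: le_trans cov; rewrite ler_nat word_links_codeg.
have card_cc : #|{: ccword n wbar}| = multinom n ((n - w) :: [seq wbar i | i : 'I_q.+1.-1]).
  by rewrite -card_words // card_sig; apply: eq_card => x; rewrite !inE.
rewrite -card_cc => /le_trans; apply.
by rewrite ler_nat; apply: (matching_ccc dodd _ Mm).
Qed.

End Asymptotics.

(* The bound with a vanishing loss *)
From mathcomp Require Import all_classical all_reals all_analysis.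
Import numFieldNormedType.Exports.
Local Open Scope classical_set_scope.
Local Open Scope ring_scope.

(** The loss at [n] is the least nonnegative one for which the inequality holds, and 0 where [B n]
    vanishes; the hypothesis at [eta] makes it eventually at most [eta]. *)
Lemma exists_vanishing_loss (R : realType) (A B : nat -> R) :
  (forall n, 0 <= A n) -> (forall n, 0 <= B n) ->
  (forall eta, 0 < eta -> exists N, forall n, (N <= n)%N -> (1 - eta) * B n <= A n) ->
  exists o : nat -> R, o @ \oo --> (0 : R) /\
    \forall n \near \oo, (1 - o n) * B n <= A n.
Proof.
move=> A0 B0 AB; exists (fun n => Num.max 0 (1 - A n / B n) *+ (B n != 0)); split.
  apply/cvgr0Pnorm_le => eta eta0; have [N leN] := AB eta eta0.
  exists N => // n /= Nn; have [_|Bn] := eqVneq (B n) 0.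
    by rewrite normr0 ltW.
  have Bn0 : 0 < B n by rewrite lt_def Bn B0.
  rewrite mulr1n ger0_norm ?le_max ?lexx // ge_max (ltW eta0) /=.
  by rewrite lerBlDr addrC -lerBlDr ler_pdivlMr // leN.
apply: nearW => n; have [->|Bn] := eqVneq (B n) 0; first by rewrite mulr0.
have Bn0 : 0 < B n by rewrite lt_def Bn B0.
rewrite -ler_pdivlMr // mulr1n lerBlDr addrC -lerBlDr.
by rewrite le_max lexx orbT.
Qed.

Theorem theorem1p6 (R : realType) (q w d : nat)
    (hq : (0 < q)%N) (hw : (0 < w)%N) (hd : (0 < d)%N) (dodd : odd d)
    (wbar : {ffun 'I_q.-1 -> nat}) (hwbar : w = (\sum_i wbar i)%N) :
  let t := ((2 * w + 1 - d) %/ 2)%N in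
  exists o : nat -> R, o @ \oo --> (0 : R) /\
    \forall n \near \oo,
      (max_ccc n d wbar)%:R >=
        (1 - o n) *
        ((multinom n ((n - w)%N :: [seq wbar i | i : 'I_q.-1]))%:R /
         ('C(n - t, w - t) * fmax wbar (w - t))%:R).
Proof.
move=> t; apply: exists_vanishing_loss => [n|n|eta eta0].
- exact: ler0n.
- by rewrite divr_ge0 // ler0n.
- case: q hq wbar hwbar => [//|q] _ wbar hwbar.
  by rewrite /t hwbar; apply: max_ccc_lower.
Qed.
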